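(* Let $d_A,d_B,q\in\mathbb{N}$ and let $\{Z_i=(d_A,d_B,d_{C_i},p_i,h_i)\}_{i\in\{1,\dots,q\}}$ be a finite set of quantum circuit topologies such that for each $i$ either $p_i<2d_A^2(d_B-1)$ or $d_{C_i}<d_A$. Then there exist an element $\mathcal{E}_0\in\mathcal{C}^{\mathrm{e}}_{d_A,d_B,d_A}$ and a neighborhood $B(\mathcal{E}_0)\subset\mathcal{C}_{d_A,d_B}$ of $\mathcal{E}_0$ (in the subspace topology of $\mathcal{C}_{d_A,d_B}$) such that every $\mathcal{E}\in B(\mathcal{E}_0)$ satisfies $\mathcal{E}\notin\bigcup_{i=1}^q H(Z_i)$.
   Context: For $s\leqslant m$, $V_{s,m}=\{V\in\mathbb{C}^{m\times s}:V^{\ast}V=I\}$ (isometries). $\mathcal{C}_{d_A,d_B}$ is the set of positive semi-definite $C\in\mathbb{C}^{d_Ad_B\times d_Ad_B}$ (on $\mathbb{C}^{d_A}\otimes\mathbb{C}^{d_B}$) with $\mathrm{tr}_B C=\frac{1}{d_A}I$; $\mathcal{C}^{\mathrm{e}}_{d_A,d_B,r}$ is the set of its elements of rank $r$ that are extreme points of the convex set $\mathcal{C}_{d_A,d_B}$. A quantum circuit topology is a 5-tuple $Z=(d_A,d_B,d_C,p,h)$ with $d_A,d_B,d_C\in\mathbb{N}$, $d_Bd_C\geqslant d_A$, $p\in\mathbb{N}_0$, and $h:[0,2\pi]^p\to V_{d_A,d_Bd_C}$ a smooth function. For $V\in V_{d_A,d_Cd_B}$ define the channel $\mathcal{E}_V(M)=\mathrm{tr}_C(VMV^{\ast})$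 for $M\in\mathbb{C}^{d_A\times d_A}$, where $\mathrm{tr}_C(X)=\sum_{i=1}^{d_C}(\langle i|\otimes I_{d_B})X(|i\rangle\otimes I_{d_B})$, and set $T(V)=\frac{1}{d_A}\sum_{i,j=1}^{d_A}|i\rangle\langle j|\otimes\mathcal{E}_V(|i\rangle\langle j|)\in\mathbb{C}^{d_Ad_B\times d_Ad_B}$ (the Choi-state of $\mathcal{E}_V$). The set generated by $Z$ is $H(Z):=T(h([0,2\pi]^p))$. *)

(* Defs.v *)
(* mathcomp + mathcomp-analysis + real-closed (complex, mxtens). *)
From mathcomp Require Import all_boot all_order all_algebra.
From mathcomp Require Import all_classical all_reals all_analysis.
From mathcomp Require Import complex mxtens.
Import Order.TTheory GRing.Theory Num.Theory.
Import numFieldNormedType.Exports.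

Set Implicit Arguments.
Unset Strict Implicit.
Unset Printing Implicit Defensive.

Local Open Scope ring_scope.

(* Complex numbers are R[i] for R : realType.  Tensor products C^m (x) C^n are
   indexed by mxtens_index (i, j) = i * n + j (standard Kronecker ordering),
   and A *t B is the Kronecker product (mxtens.v). *)

Section QuantumDefs.
Variable R : realType.
Local Notation C := (R[i]).

(* conjugate transpose A^* *)
Definition adjmx m n (A : 'M[C]_(m, n)) : 'M[C]_(n, m) :=
  (map_mx (fun x : C => x^*) A)^T.

(* positive semi-definite: v^* A v >= 0 for all v *)
Definition psd n (A : 'M[C]_n) : Prop :=
  forall v : 'cV[C]_n, 0 <= (adjmx v *m A *m v) 0 0.

(* isometries V_{s,m} = {V in C^{m x s} : V^* V = I} *)
Definition isometry m s (V : 'M[C]_(m, s)) : Prop := adjmx V *m V = 1%:M.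

(* partial trace over the second factor B of C^{dA} (x) C^{dB} *)
Definition ptraceB dA dB (X : 'M[C]_(dA * dB)) : 'M[C]_dA :=
  \matrix_(i, j) \sum_(k < dB) X (mxtens_index (i, k)) (mxtens_index (j, k)).

(* partial trace over the first factor C of C^{dC} (x) C^{dB} :
   tr_C X = sum_c (<c| (x) I) X (|c> (x) I) *)
Definition ptraceC dC dB (X : 'M[C]_(dC * dB)) : 'M[C]_dB :=
  \matrix_(b, b') \sum_(c < dC) X (mxtens_index (c, b)) (mxtens_index (c, b')).

(* the set C_{dA,dB} of Choi states *)
Definition choi_set dA dB (X : 'M[C]_(dA * dB)) : Prop :=
  psd X /\ ptraceB X = (dA%:R)^-1%:M.

(* extreme points of a (convex) set of matrices, real convex combinations *)
Definition extreme_point n (S : 'M[C]_n -> Prop) (X : 'M[C]_n) : Prop :=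
  S X /\ forall (Y Z : 'M[C]_n) (t : R), S Y -> S Z -> 0 < t < 1 ->
    X = (t%:C)%C *: Y + ((1 - t)%:C)%C *: Z -> Y = X /\ Z = X.

(* C^e_{dA,dB,r} *)
Definition choi_extreme_rank dA dB r (X : 'M[C]_(dA * dB)) : Prop :=
  extreme_point (@choi_set dA dB) X /\ \rank X = r.

(* the channel E_V(M) = tr_C (V M V^dagger) *)
Definition channel dA dB dC (V : 'M[C]_(dC * dB, dA)) (M : 'M[C]_dA) : 'M[C]_dB :=
  ptraceC (V *m M *m adjmx V).

(* T(V) = 1/dA sum_{i,j} |i><j| (x) E_V(|i><j|) *)
Definition choi_state dA dB dC (V : 'M[C]_(dC * dB, dA)) : 'M[C]_(dA * dB) :=
  (dA%:R)^-1 *: \sum_(i < dA) \sum_(j < dA)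
     (delta_mx i j *t channel V (delta_mx i j)).

(* parameter cube [0, 2 pi]^p *)
Definition param_cube p : set 'rV[R]_p :=
  fun x => forall k : 'I_p, 0 <= x 0 k <= 2 * pi.

(* iterated partial derivatives d_{i1} d_{i2} ... f *)
Definition partialD p (i : 'I_p) (f : 'rV[R]_p -> R) : 'rV[R]_p -> R :=
  fun x => 'D_(delta_mx 0 i) f x.

Fixpoint iter_partialD p (l : seq 'I_p) (f : 'rV[R]_p -> R) : 'rV[R]_p -> R :=
  match l with
  | [::] => f
  | i :: l' => partialD i (iter_partialD l' f)
  end.

(* f is C^infinity on the set U: all iterated partial derivatives exist
   and are continuous at every point of U *)
Definition smooth_on p (U : set 'rV[R]_p) (f : 'rV[R]_p -> R) : Prop :=
  forall (l : seq 'I_p) (x : 'rV[R]_p), U x ->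
    {for x, continuous (iter_partialD l f)} /\
    forall i : 'I_p, derivable (iter_partialD l f) x (delta_mx 0 i).

(* h : [0,2pi]^p -> C^{m x s} is smooth: it agrees on the cube with a function
   whose real and imaginary parts of all entries are smooth on an open
   neighbourhood of the cube *)
Definition smooth_on_cube p m s (h : 'rV[R]_p -> 'M[C]_(m, s)) : Prop :=
  exists (U : set 'rV[R]_p) (g : 'rV[R]_p -> 'M[C]_(m, s)),
    open U /\ (forall x, param_cube x -> U x) /\
    (forall x, param_cube x -> g x = h x) /\
    forall a b, smooth_on U (fun x => complex.Re (g x a b)) /\
                smooth_on U (fun x => complex.Im (g x a b)).

(* a quantum circuit topology Z = (dA, dB, dC, p, h) *)
Definition circuit_topology dA dB dC p (h : 'rV[R]_p -> 'M[C]_(dC * dB, dA)) : Prop :=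
  (dA <= dB * dC)%N /\ (0 < dC)%N /\
  (forall x, param_cube x -> isometry (h x)) /\ smooth_on_cube h.

(* H(Z) = T(h([0,2pi]^p)) *)
Definition generated_set dA dB dC p (h : 'rV[R]_p -> 'M[C]_(dC * dB, dA))
  (X : 'M[C]_(dA * dB)) : Prop :=
  exists x, param_cube x /\ choi_state (h x) = X.

End QuantumDefs.

(* Main.v *)
Require Import Defs.
From mathcomp Require Import all_boot all_order all_algebra.
From mathcomp Require Import all_classical all_reals all_analysis.
From mathcomp Require Import complex mxtens.
From mathcomp Require Import ring lra.
Import Order.TTheory GRing.Theory Num.Theory.
Import numFieldNormedType.Exports.
Local Open Scope ring_scope.

(** Write [d = dA] and [n = dB].  Prescribe small matrices [W_b] for [1 <= b < n]
    and put [Y_0 = 1], [Y_b = W_b].  The equation [P + sum_b W_b^* P W_b = 1] is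
    linear in [P] and, the sum being a contraction, has a unique solution, which
    is Hermitian, close to the identity and hence positive definite.  The matrix
    with blocks [Y_b^* P Y_b' / d] is then a Choi state of rank [d]; any
    Choi state occurring in a convex decomposition of it vanishes on the same
    kernel, hence has blocks [Y_b^* T Y_b'] with [T + sum_b W_b^* T W_b = 1 / d],
    so it is equal to it: the point is extreme.  Since [W_b] is recovered in a
    Lipschitz way from the blocks [(0, 0)] and [(0, b)], this is a family of
    extreme points with [2 d^2 (n - 1)] real parameters which does not contract
    distances by more than a constant.

    A circuit with [p] parameters is Lipschitz on its cube, so its image is covered
    by [N ^ p] balls of radius [L / N].  Comparing with a grid of
    [M ^ (2 d^2 (n - 1))] well separated members of the family, [N] being a constant
    multiple of [M], some member stays away from all the balls coming
    from circuits with [p < 2 d^2 (n - 1)].  Circuits with [dC < d] only produce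
    states of rank [< d], while all matrices near the family have rank [>= d]. *)

(** * Invertibility near the identity *)

Lemma contraction_eq0 (K : numFieldType) (k s : K) :
  0 <= s -> k < 1 -> s <= k * s -> s = 0.
Proof.
move=> s0 k1 hs; apply/eqP; rewrite eq_le s0 andbT.
have : (1 - k) * s <= 0 by rewrite mulrBl mul1r subr_le0.
by rewrite pmulr_rle0 ?subr_gt0.
Qed.

(** A row vector [v] killed by [M] satisfies [v = - v (M - 1)], so each of its [d] entries is at
    most [eta] times its l1 norm; as [d * eta < 1], that norm is zero. *)
Lemma near_one_unitmx {K : numFieldType} {d} (M : 'M[K]_d) (eta : K) :
  (forall i j, `|(M - 1%:M) i j| <= eta) -> d%:R * eta < 1 -> M \in unitmx.
Proof.
move=> hM hd; rewrite -row_free_unit; apply: inj_row_free => v vM.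
have vE j : `|v 0 j| <= eta * \sum_i `|v 0 i|.
  have -> : v 0 j = - (v *m (M - 1%:M)) 0 j.
    by rewrite mulmxBr vM mulmx1 sub0r mxE opprK.
  rewrite normrN mxE (le_trans (ler_norm_sum _ _ _)) // mulr_sumr ler_sum //.
  by move=> i _; rewrite normrM mulrC ler_wpM2r.
have s0 : \sum_i `|v 0 i| = 0.
  apply: (@contraction_eq0 _ (d%:R * eta)) => //; first by rewrite sumr_ge0.
  rewrite -mulrA mulr_natl -[X in _ *+ X]card_ord -sumr_const ler_sum //.
apply/rowP => j; rewrite mxE; apply/eqP; rewrite -normr_le0 (le_trans (vE j)) //.
by rewrite s0 mulr0.
Qed.

(** * Adjoints and kernels of positive semi-definite forms *)

Section Adjoint.
Context {R : realType}.
Local Notation C := (R[i]).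

Lemma adjmxE m n (A : 'M[C]_(m, n)) i j : adjmx A i j = (A j i)^*.
Proof. by rewrite !mxE. Qed.

Lemma adjmxK m n (A : 'M[C]_(m, n)) : adjmx (adjmx A) = A.
Proof. by apply/matrixP => i j; rewrite !adjmxE conjCK. Qed.

Lemma adjmxM m n p (A : 'M[C]_(m, n)) (B : 'M[C]_(n, p)) :
  adjmx (A *m B) = adjmx B *m adjmx A.
Proof.
apply/matrixP => i j; rewrite adjmxE !mxE rmorph_sum; apply: eq_bigr => k _.
by rewrite !adjmxE rmorphM mulrC.
Qed.

Lemma adjmxD m n (A B : 'M[C]_(m, n)) : adjmx (A + B) = adjmx A + adjmx B.
Proof. by apply/matrixP => i j; rewrite !(adjmxE, mxE) rmorphD. Qed.

Lemma adjmx_sum m n I (r : seq I) (A : I -> 'M[C]_(m, n)) :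
  adjmx (\sum_(i <- r) A i) = \sum_(i <- r) adjmx (A i).
Proof.
elim/big_rec2: _ => [|i x y _ <-]; last exact: adjmxD.
by apply/matrixP => i j; rewrite adjmxE !mxE conjC0.
Qed.

Lemma adjmx1 n : adjmx (1%:M : 'M[C]_n) = 1%:M.
Proof. by apply/matrixP => i j; rewrite adjmxE !mxE conjC_nat eq_sym. Qed.

Lemma adjmxZ m n (a : C) (A : 'M[C]_(m, n)) : adjmx (a *: A) = a^* *: adjmx A.
Proof. by apply/matrixP => i j; rewrite !(adjmxE, mxE) rmorphM. Qed.

(** At [w + z *: v] the form is affine in [z] and its conjugate, because the quadratic term
    vanishes. Being nonnegative for every complex [z], it is constant; [z = 1] and [z = 'i] then
    separate the two cross terms. Both are stated since [psd] does not mention that [A] is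
    Hermitian. *)
Lemma psd_kernel {n} {A : 'M[C]_n} {v : 'cV[C]_n} (w : 'cV[C]_n) : psd A ->
  (adjmx v *m A *m v) 0 0 = 0 ->
  (adjmx w *m A *m v) 0 0 = 0 /\ (adjmx v *m A *m w) 0 0 = 0.
Proof.
move=> hA hv.
set a := (adjmx w *m A *m v) 0 0; set b := (adjmx v *m A *m w) 0 0.
set c := (adjmx w *m A *m w) 0 0.
have hz (z : C) : 0 <= c + z * a + z^* * b.
  have := hA (w + z *: v).
  rewrite adjmxD adjmxZ !mulmxDl !mulmxDr -!scalemxAl -!scalemxAr.
  have addE (A1 A2 : 'M[C]_1) : (A1 + A2) 0 0 = A1 0 0 + A2 0 0 by rewrite mxE.
  have scaleE x (A1 : 'M[C]_1) : (x *: A1) 0 0 = x * A1 0 0 by rewrite mxE.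
  by rewrite !(addE, scaleE) hv -/a -/b -/c !mulr0 addr0.
have c0 : 0 <= c by exact: hA.
have re z : z * a + z^* * b \is Num.real.
  have -> : z * a + z^* * b = - c + (c + z * a + z^* * b) by rewrite -addrA addKr.
  by apply: rpredD; rewrite ?rpredN ger0_real.
have key z : z * a + z^* * b = 0.
  apply/eqP/contraT => nz; set t := _ + _ in nz.
  have t0 : t \is Num.real by exact: re.
  (* This real multiple brings the affine expression down to [c + x * t = -1]. *)
  pose x := - (c + 1) / t.
  have xr : x^* = x.
    apply/CrealP; rewrite /x rpredM ?rpredV // rpredN rpredD ?real1 //.
    exact: ger0_real.
  have := hz (x * z).
  have -> : c + x * z * a + (x * z)^* * b = c + x * t.
    by rewrite rmorphM /= xr /t mulrDr !mulrA addrA.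
  rewrite divfK // opprD addrA subrr add0r.
  by rewrite oppr_ge0 ler10.
have e1 := key 1; have e2 := key 'i.
rewrite conjC1 !mul1r in e1; rewrite conjCi in e2.
have eb : b = - a by apply/eqP; rewrite -addr_eq0 addrC e1.
have : 2%:R * 'i * a = 0 by rewrite -[RHS]e2 eb; ring.
move/eqP; rewrite !mulf_eq0 pnatr_eq0 (negbTE (neq0Ci _)) /= => /eqP a0.
by rewrite eb a0 oppr0.
Qed.

Lemma psd_kernel_mx n p (A : 'M[C]_n) (N : 'M[C]_(n, p)) : psd A ->
  (forall v : 'cV_p, (adjmx (N *m v) *m A *m (N *m v)) 0 0 = 0) ->
  A *m N = 0 /\ adjmx N *m A = 0.
Proof.
move=> hA hN.
split.
  apply/matrixP => i j; rewrite [RHS]mxE.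
  have [+ _] := psd_kernel (delta_mx i 0) hA (hN (delta_mx j 0)).
  have -> : adjmx (delta_mx i 0 : 'cV[C]_n) = delta_mx 0 i.
    by apply/matrixP => a b; rewrite adjmxE !mxE conjC_nat andbC.
  by rewrite -mulmxA -rowE !mulmxA -colE !mxE.
apply/matrixP => i j; rewrite [RHS]mxE.
have [_ +] := psd_kernel (delta_mx j 0) hA (hN (delta_mx i 0)).
rewrite adjmxM.
have -> : adjmx (delta_mx i 0 : 'cV[C]_p) = delta_mx 0 i.
  by apply/matrixP => a b; rewrite adjmxE !mxE conjC_nat andbC.
by rewrite -!mulmxA -rowE !mulmxA -colE !mxE.
Qed.

End Adjoint.

(** * Block matrices and the normalizing equation *)

Section Family.
Context {R : realType} {d m : nat}.
Local Notation C := (R[i]).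
Implicit Types (W : 'I_m -> 'M[C]_d) (T : 'M[C]_d) (eps : C).

Definition blocks W (b : 'I_m.+1) : 'M[C]_d :=
  if unlift ord0 b is Some b' then W b' else 1%:M.

(** Columns are indexed by pairs [(i, b)] in Kronecker order, so the blocks [Y_b] are interleaved
    rather than juxtaposed. *)
Definition block_row W : 'M[C]_(d, d * m.+1) :=
  \matrix_(c, s) blocks W (mxtens_unindex s).2 c (mxtens_unindex s).1.

Definition sandwich W T : 'M[C]_(d * m.+1) :=
  adjmx (block_row W) *m T *m block_row W.

Definition pullback W T : 'M[C]_d := \sum_b adjmx (W b) *m T *m W b.

Definition first_block (X : 'M[C]_(d * m.+1)) (b : 'I_m.+1) : 'M[C]_d :=
  \matrix_(i, j) X (mxtens_index (i, ord0)) (mxtens_index (j, b)).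

Definition norm1 T : C := \sum_i \sum_j `|T i j|.

Lemma norm1_ge0 T : 0 <= norm1 T.
Proof. by apply: sumr_ge0 => i _; apply: sumr_ge0. Qed.

Lemma norm1_le T (a : C) : (forall i j, `|T i j| <= a) -> norm1 T <= d%:R ^+ 2 * a.
Proof.
move=> hT; have -> : d%:R ^+ 2 * a = \sum_(i < d) \sum_(j < d) a.
  by rewrite !sumr_const !card_ord expr2 -mulrA !mulr_natl.
by apply: ler_sum => i _; apply: ler_sum.
Qed.

Lemma entry_le_norm1 T i j : `|T i j| <= norm1 T.
Proof.
rewrite /norm1 (bigD1 i) //= (bigD1 j) //= -addrA lerDl addr_ge0 //.
  by rewrite sumr_ge0.
by apply: sumr_ge0 => k _; rewrite sumr_ge0.
Qed.

Lemma norm1_eq0 T : norm1 T = 0 -> T = 0.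
Proof.
move=> T0; apply/matrixP => i j; rewrite mxE; apply/eqP.
by rewrite -normr_le0 -T0 entry_le_norm1.
Qed.

Lemma norm1D T T' : norm1 (T + T') <= norm1 T + norm1 T'.
Proof.
rewrite -big_split ler_sum // => i _; rewrite -big_split ler_sum // => j _ /=.
by rewrite mxE ler_normD.
Qed.

Lemma norm1N T : norm1 (- T) = norm1 T.
Proof. by apply: eq_bigr => i _; apply: eq_bigr => j _; rewrite mxE normrN. Qed.

Lemma sandwichE W T i b j b' :
  sandwich W T (mxtens_index (i, b)) (mxtens_index (j, b')) =
  (adjmx (blocks W b) *m T *m blocks W b') i j.
Proof.
rewrite !mxE; apply: eq_bigr => k _; rewrite !mxE !mxtens_indexK /=; congr (_ * _).
by apply: eq_bigr => l _; rewrite !mxE mxtens_indexK.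
Qed.

Lemma ptraceB_sandwich W T : ptraceB (sandwich W T) = T + pullback W T.
Proof.
apply/matrixP => i j; rewrite !mxE big_ord_recl sandwichE /blocks unlift_none.
rewrite adjmx1 mul1mx mulmx1; congr (_ + _); rewrite summxE; apply: eq_bigr => b _.
by rewrite sandwichE /blocks liftK.
Qed.

(** As [Y_0 = 1], the first block row shows [T] itself and then each [T W_b]; this is what makes [W]
    recoverable. *)
Lemma first_block_sandwich W T b :
  first_block (sandwich W T) b = T *m blocks W b.
Proof.
apply/matrixP => i j; rewrite mxE sandwichE.
by rewrite {1}/blocks unlift_none adjmx1 mul1mx.
Qed.

(** The inclusion of the coordinates with [b = 0]: a right inverse of [block_row W], the same for
    all [W]. *)
Definition first_cols : 'M[C]_(d * m.+1, d) :=
  \matrix_(s, j) (s == mxtens_index (j, ord0))%:R.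

Lemma mulmx_first_cols p (A : 'M[C]_(p, d * m.+1)) i j :
  (A *m first_cols) i j = A i (mxtens_index (j, ord0)).
Proof.
rewrite mxE (bigD1 (mxtens_index (j, ord0))) //= mxE eqxx mulr1 big1 ?addr0 //.
by move=> s /negPf sj; rewrite mxE sj mulr0.
Qed.

Lemma block_row_first_cols W : block_row W *m first_cols = 1%:M.
Proof.
apply/matrixP => i j.
by rewrite mulmx_first_cols mxE mxtens_indexK /= /blocks unlift_none.
Qed.

Lemma adj_first_cols_mulmx (A : 'M[C]_(d * m.+1)) :
  adjmx first_cols *m A *m first_cols = first_block A ord0.
Proof.
apply/matrixP => i j; rewrite mulmx_first_cols [RHS]mxE mxE.
rewrite (bigD1 (mxtens_index (i, ord0))) //= !mxE eqxx conjC1 mul1r big1 ?addr0 //.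
by move=> s /negPf si; rewrite !mxE si conjC0 mul0r.
Qed.

Lemma pullbackB W T T' : pullback W (T - T') = pullback W T - pullback W T'.
Proof.
rewrite /pullback -sumrB; apply: eq_bigr => b _.
by rewrite mulmxBr mulmxBl.
Qed.

Lemma adj_pullback W T : adjmx (pullback W T) = pullback W (adjmx T).
Proof.
rewrite /pullback adjmx_sum; apply: eq_bigr => b _.
by rewrite !adjmxM adjmxK mulmxA.
Qed.

Lemma pullback_le W T eps i j : (forall b k l, `|W b k l| <= eps) ->
  `|pullback W T i j| <= m%:R * eps ^+ 2 * norm1 T.
Proof.
move=> hW; rewrite summxE (le_trans (ler_norm_sum _ _ _)) //.
rewrite -mulrA mulr_natl -[X in _ *+ X]card_ord -sumr_const ler_sum // => b _.
rewrite mxE (le_trans (ler_norm_sum _ _ _)) //.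
rewrite /norm1 exchange_big mulr_sumr ler_sum // => k _.
rewrite mxE normrM.
have eps0 : 0 <= eps by exact: le_trans (hW b i j).
apply: (@le_trans _ _ ((\sum_l `|T l k| * eps) * eps)).
  rewrite ler_pM // (le_trans (ler_norm_sum _ _ _)) // ler_sum // => l _.
  by rewrite normrM adjmxE norm_conjC mulrC ler_wpM2l.
by rewrite -mulr_suml -mulrA mulrC -expr2.
Qed.

(** * The normalizer: existence, uniqueness, positivity *)

Section Contraction.
Variables (W : 'I_m -> 'M[C]_d) (eps : C).
Hypothesis eps_ge0 : 0 <= eps.
Hypothesis W_le : forall b i j, `|W b i j| <= eps.
Hypothesis eps_small : m%:R * eps ^+ 2 * d%:R ^+ 2 <= 4%:R^-1.

Lemma norm1_pullback T : norm1 (pullback W T) <= 4%:R^-1 * norm1 T.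
Proof.
apply: (le_trans (norm1_le _ _ (fun i j => pullback_le W T _ i j W_le))).
by rewrite mulrA [d%:R ^+ 2 * _]mulrC ler_wpM2r ?norm1_ge0.
Qed.

(** The difference [T - T'] equals minus its own pullback, and pulling back divides [norm1] by at
    least 4. *)
Lemma add_pullback_inj T T' :
  T + pullback W T = T' + pullback W T' -> T = T'.
Proof.
move=> e; apply/eqP; rewrite -subr_eq0; apply/eqP/norm1_eq0.
apply: (@contraction_eq0 _ 4%:R^-1); first exact: norm1_ge0.
  by rewrite invf_lt1 ?ltr1n ?ltr0n.
have {1}-> : T - T' = - pullback W (T - T').
  apply/eqP; rewrite -addr_eq0 pullbackB addrACA -opprD subr_eq0; exact/eqP.
by rewrite norm1N norm1_pullback.
Qed.

(** [A] is the matrix of [T |-> T + pullback W T] on vectorized matrices; in finite dimension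
    injectivity makes it invertible. *)
Lemma exists_normalizer : exists P : 'M[C]_d, P + pullback W P = 1%:M.
Proof.
pose A := 1%:M + \sum_b lin_mulmx (adjmx (W b)) *m lin_mulmxr (W b).
have AE T : mxvec T *m A = mxvec (T + pullback W T).
  rewrite mulmxDr mulmx1 linearD; congr (_ + _).
  rewrite mulmx_sumr linear_sum; apply: eq_bigr => b _.
  by rewrite mulmxA !mul_vec_lin.
have uA : A \in unitmx.
  rewrite -row_free_unit; apply: inj_row_free => v.
  rewrite -[v]vec_mxK AE => /eqP; rewrite mxvec_eq0 => /eqP e.
  suff -> : vec_mx v = 0 by rewrite linear0.
  apply: add_pullback_inj; rewrite e /pullback big1 ?addr0 // => b _.
  by rewrite mulmx0 mul0mx.
exists (vec_mx (mxvec 1%:M *m invmx A)); apply: (can_inj mxvecK).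
by rewrite -AE vec_mxK mulmxKV.
Qed.

Variable P : 'M[C]_d.
Hypothesis P_eq : P + pullback W P = 1%:M.

(** The adjoint of [P] solves the same equation. *)
Lemma normalizer_adj : adjmx P = P.
Proof.
by apply: add_pullback_inj; rewrite -adj_pullback -adjmxD P_eq adjmx1.
Qed.

(** From [P = 1 - pullback W P] one gets [norm1 P <= d + norm1 P / 4], hence [norm1 P <= 2 d]. An
    entry of the pullback is then at most [m eps^2 * 2 d], which [eps_small] bounds by
    [1 / (2 d)]. *)
Lemma normalizer_near1 i j : `|(P - 1%:M) i j| <= (2%:R * d%:R)^-1.
Proof.
have d0 : 0 < d%:R :> C by rewrite ltr0n; case: (d) i => // -[].
have -> : (P - 1%:M) i j = - pullback W P i j.
  by rewrite -P_eq opprD addrA subrr add0r mxE.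
rewrite normrN (le_trans (pullback_le _ _ _ _ _ W_le)) //.
have S1 : norm1 (1%:M : 'M[C]_d) = d%:R.
  rewrite /norm1 -[d in RHS]card_ord -sumr_const; apply: eq_bigr => k _.
  rewrite (bigD1 k) //= !mxE eqxx normr1 big1 ?addr0 // => l /negPf lk.
  by rewrite mxE eq_sym lk normr0.
have SP : norm1 P <= 2%:R * d%:R.
  have : norm1 P <= d%:R + 4%:R^-1 * norm1 P.
    have PE : P = 1%:M - pullback W P by rewrite -P_eq addrK.
    by rewrite {1}PE (le_trans (norm1D _ _)) // norm1N S1 lerD2l norm1_pullback.
  rewrite -lerBlDr -{1}[norm1 P]mul1r -mulrBl => h.
  have : 2%:R^-1 * norm1 P <= d%:R.
    apply: le_trans h; rewrite ler_wpM2r ?norm1_ge0 //.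
    rewrite -subr_ge0; have -> : 1 - 4%:R^-1 - 2%:R^-1 = 4%:R^-1 :> C by field.
    by rewrite invr_ge0.
  by rewrite ler_pdivrMl.
have e0 : 0 <= m%:R * eps ^+ 2.
  by rewrite mulr_ge0 // exprn_ge0.
rewrite (le_trans (ler_wpM2l e0 SP)) // -[leRHS]mul1r ler_pdivlMr ?mulr_gt0 //.
have -> : m%:R * eps ^+ 2 * (2%:R * d%:R) * (2%:R * d%:R)
  = 4%:R * (m%:R * eps ^+ 2 * d%:R ^+ 2) :> C by ring.
by rewrite -ler_pdivlMl // mulr1.
Qed.

Lemma normalizer_unitmx : P \in unitmx.
Proof.
case: (posnP d) => [d0|d0].
  have -> : P = 1%:M by apply/matrixP => i; have := ltn_ord i; rewrite [X in (_ < X)%N]d0.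
  exact: unitmx1.
apply: near_one_unitmx normalizer_near1 _.
by rewrite invfM mulrCA divff ?pnatr_eq0 -?lt0n // mulr1 invf_lt1 ?ltr1n.
Qed.

(** The form of [P] at [v] is [n + w], with [n] the squared norm of [v] and [w] the real
    contribution of [P - 1]. Entries of size [1 / (2 d)] and [|v_i| |v_j| <= |v_i|^2 + |v_j|^2] give
    [|w| <= n]. *)
Lemma normalizer_psd : psd P.
Proof.
move=> v; set n := \sum_i `|v i 0| ^+ 2; set w := (adjmx v *m (P - 1%:M) *m v) 0 0.
have -> : (adjmx v *m P *m v) 0 0 = n + w.
  have -> : n = (adjmx v *m v) 0 0.
    by rewrite mxE; apply: eq_bigr => i _; rewrite adjmxE normCKC.
  have subE (A1 A2 : 'M[C]_1) : (A1 - A2) 0 0 = A1 0 0 - A2 0 0 by rewrite !mxE.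
  by rewrite /w mulmxBr mulmxBl mulmx1 subE addrC subrK.
have n0 : 0 <= n by apply: sumr_ge0 => i _; rewrite exprn_ge0.
have wr : w \is Num.real.
  apply/CrealP; rewrite -adjmxE /w !adjmxM adjmxK mulmxA.
  by rewrite -scaleN1r adjmxD adjmxZ normalizer_adj adjmx1 conjCN1.
have wn : `|w| <= n.
  rewrite /w mxE (le_trans (ler_norm_sum _ _ _)) //.
  apply: (@le_trans _ _ (\sum_(j < d) \sum_(i < d)
     (2%:R * d%:R)^-1 * (`|v i 0| ^+ 2 + `|v j 0| ^+ 2))).
    apply: ler_sum => j _; rewrite normrM mxE.
    apply: (le_trans (ler_wpM2r (normr_ge0 _) (ler_norm_sum _ _ _))).
    rewrite mulr_suml ler_sum // => i _; rewrite normrM adjmxE norm_conjC.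
    rewrite mulrAC [leLHS]mulrC ler_pM ?mulr_ge0 ?normalizer_near1 //.
    have : 0 <= (`|v i 0| - `|v j 0|) ^+ 2 by rewrite real_exprn_even_ge0 ?rpredB ?normr_real.
    rewrite sqrrB -addrA addrCA -addrC subr_ge0 => h.
    by rewrite (le_trans _ h) // -mulr_natl ler_peMl ?mulr_ge0 ?ler1n.
  have -> : \sum_(j < d) \sum_(i < d) (2%:R * d%:R)^-1 * (`|v i 0| ^+ 2 + `|v j 0| ^+ 2)
     = (2%:R * d%:R)^-1 * (2%:R * d%:R) * n.
    under eq_bigr do rewrite -mulr_sumr big_split /=.
    rewrite -mulr_sumr big_split /= sumr_const card_ord.
    under [X in _ + X]eq_bigr do rewrite sumr_const card_ord.
    by rewrite sumrMnl -/n -[n *+ d]mulr_natl; set a := _^-1; ring.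
  (* For [d = 0] the inverse is 0 by convention and the bound reads [0 <= n]. *)
  case: (posnP d) => [d0|d0]; last by rewrite mulVf ?mul1r ?mulf_neq0 ?pnatr_eq0 -?lt0n.
  by rewrite {1}d0 mulr0 invr0 !mul0r.
by have := real_lerNnormlW wr wn; rewrite -subr_ge0 opprK addrC.
Qed.

End Contraction.
End Family.

(** * The family of extreme Choi states *)

Section ExtremeFamily.
Context {R : realType} {d m : nat}.
Local Notation C := (R[i]).
Implicit Types (W : 'I_m -> 'M[C]_d) (P Q : 'M[C]_d) (eps : C).

Definition admissible (eps : C) W P :=
  (forall b i j, `|W b i j| <= eps) /\ P + pullback W P = 1%:M.

Definition choi_family W P : 'M[C]_(d * m.+1) := sandwich W (d%:R^-1 *: P).

Lemma pullbackZ W a T : pullback W (a *: T) = a *: pullback W T.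
Proof.
rewrite /pullback scaler_sumr; apply: eq_bigr => b _.
by rewrite -scalemxAr -scalemxAl.
Qed.

Lemma psd_sandwich W Q : psd Q -> psd (sandwich W Q).
Proof.
by move=> hQ v; have := hQ (block_row W *m v); rewrite adjmxM /sandwich !mulmxA.
Qed.

Variable eps : C.
Hypothesis d_gt0 : (0 < d)%N.
Hypothesis eps_ge0 : 0 <= eps.
Hypothesis eps_small : m%:R * eps ^+ 2 * d%:R ^+ 2 <= 4%:R^-1.

Section OneMember.
Variables (W : 'I_m -> 'M[C]_d) (P : 'M[C]_d).
Hypothesis WP : admissible eps W P.

Let W_le : forall b i j, `|W b i j| <= eps := proj1 WP.
Let P_eq : P + pullback W P = 1%:M := proj2 WP.

Lemma choi_family_in : choi_set (choi_family W P).
Proof.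
split; last by rewrite ptraceB_sandwich pullbackZ -scalerDr P_eq scalemx1.
apply: psd_sandwich => v; rewrite -scalemxAr -scalemxAl mxE mulr_ge0 ?invr_ge0 //.
exact: (normalizer_psd _ _ eps_ge0 W_le eps_small _ P_eq).
Qed.

Lemma choi_family_first_block b :
  first_block (choi_family W P) b = d%:R^-1 *: (P *m blocks W b).
Proof. by rewrite first_block_sandwich -scalemxAl. Qed.

(** The block [(0, 0)] is a compression of [X], so its rank [d] bounds that of [X] from below. *)
Lemma rank_first_block (X : 'M[C]_(d * m.+1)) :
  first_block X ord0 \in unitmx -> (d <= \rank X)%N.
Proof.
move=> uX; rewrite -{1}(mxrank_unit uX) -adj_first_cols_mulmx.
by rewrite (leq_trans (mxrankM_maxl _ _)) // mxrankM_maxr.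
Qed.

Lemma rank_choi_family : \rank (choi_family W P) = d.
Proof.
apply/eqP; rewrite eqn_leq; apply/andP; split.
  by rewrite /choi_family /sandwich -mulmxA mulmx_max_rank.
apply: rank_first_block; rewrite choi_family_first_block /blocks unlift_none mulmx1.
rewrite unitmxZ ?(normalizer_unitmx _ _ eps_ge0 W_le eps_small _ P_eq) //.
by rewrite unitfE invr_neq0 // pnatr_eq0 -lt0n.
Qed.

(** With [B = block_row W] and [F = first_cols], the matrix [N = 1 - F B] projects onto the kernel
    of [B]. Positivity gives [X N = 0] and [N^* X = 0], so [X = B^* (F^* X F) B]. The partial trace
    condition then determines the middle factor by [add_pullback_inj]. *)
Lemma choi_family_unique (X : 'M[C]_(d * m.+1)) : choi_set X ->
  (forall v : 'cV_(d * m.+1), block_row W *m v = 0 -> (adjmx v *m X *m v) 0 0 = 0) ->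
  X = choi_family W P.
Proof.
move=> [hX tX] kX; pose N : 'M[C]_(d * m.+1) := 1%:M - first_cols *m block_row W.
have BN : block_row W *m N = 0.
  by rewrite mulmxBr mulmx1 mulmxA block_row_first_cols mul1mx subrr.
have [] := psd_kernel_mx _ _ _ N hX _.
  by move=> v; apply: kX; rewrite mulmxA BN mul0mx.
rewrite /N mulmxBr mulmx1 mulmxA => /subr0_eq e1.
rewrite -scaleN1r adjmxD adjmxZ adjmx1 adjmxM conjCN1 scaleN1r.
rewrite mulmxBl mul1mx => /subr0_eq e2.
have XE : X = sandwich W (first_block X ord0).
  by rewrite -adj_first_cols_mulmx /sandwich {1}e1 {1}e2 !mulmxA.
rewrite XE /choi_family; congr sandwich.
apply: (add_pullback_inj _ _ W_le eps_small).
by rewrite -ptraceB_sandwich -XE tX pullbackZ -scalerDr P_eq scalemx1.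
Qed.

Lemma choi_family_extreme : choi_extreme_rank d (choi_family W P).
Proof.
split; last exact: rank_choi_family.
split; first exact: choi_family_in.
move=> Y Z t hY hZ /andP[t0 t1] XE.
have tC : 0 < (t%:C)%C :> C by rewrite ltcR.
have tC1 : 0 < ((1 - t)%:C)%C :> C by rewrite ltcR subr_gt0.
(* On the kernel of [block_row W] two nonnegative values, with positive weights, add up to zero. *)
have key (v : 'cV_(d * m.+1)) : block_row W *m v = 0 ->
    (adjmx v *m Y *m v) 0 0 = 0 /\ (adjmx v *m Z *m v) 0 0 = 0.
  move=> Bv.
  have : (adjmx v *m choi_family W P *m v) 0 0 = 0.
    by rewrite /choi_family /sandwich -!mulmxA Bv !mulmx0 mxE.
  rewrite XE mulmxDr mulmxDl -!scalemxAr -!scalemxAl.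
  have addE (A1 A2 : 'M[C]_1) : (A1 + A2) 0 0 = A1 0 0 + A2 0 0 by rewrite mxE.
  have scaleE x (A1 : 'M[C]_1) : (x *: A1) 0 0 = x * A1 0 0 by rewrite mxE.
  rewrite addE !scaleE => /eqP.
  have Y0 : 0 <= (adjmx v *m Y *m v) 0 0 by exact: (hY.1 v).
  have Z0 : 0 <= (adjmx v *m Z *m v) 0 0 by exact: (hZ.1 v).
  rewrite paddr_eq0; [|by apply: mulr_ge0 => //; exact: ltW..].
  rewrite !mulf_eq0 (gt_eqF tC) (gt_eqF tC1) /=.
  by move=> /andP[/eqP -> /eqP ->].
by split; apply: choi_family_unique => // v /key[].
Qed.

(** [d] times the first block of [X] differs from the identity by at most [d e + 1 / (2 d)] per
    entry, and [d] times this is below 1. *)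
Lemma rank_near_choi_family (X : 'M[C]_(d * m.+1)) (e : C) :
  d%:R ^+ 2 * e < 2%:R^-1 ->
  (forall r s, `|X r s - choi_family W P r s| <= e) -> (d <= \rank X)%N.
Proof.
move=> he hX; apply: rank_first_block.
have d0 : 0 < d%:R :> C by rewrite ltr0n.
suff : d%:R *: first_block X ord0 \in unitmx.
  by rewrite unitmxZ // unitfE gt_eqF.
apply: (@near_one_unitmx _ _ _ (d%:R * e + (2%:R * d%:R)^-1)) => [i j|].
  have -> : (d%:R *: first_block X ord0 - 1%:M) i j =
    d%:R * (first_block X ord0 i j - first_block (choi_family W P) ord0 i j)
     + (P - 1%:M) i j.
    rewrite choi_family_first_block /blocks unlift_none mulmx1 !mxE.
    by rewrite mulrBr (mulrA d%:R) mulfV ?(gt_eqF d0) // mul1r addrA subrK.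
  rewrite (le_trans (ler_normD _ _)) // lerD //.
    by rewrite normrM (ger0_norm (ltW d0)) (ler_wpM2l (ltW d0)) // ![first_block _ _ _ _]mxE.
  exact: (normalizer_near1 _ _ eps_ge0 W_le eps_small _ P_eq).
rewrite mulrDr mulrA -expr2 invfM mulrCA divff ?(gt_eqF d0) // mulr1.
by rewrite -ltrBrDr; have -> : 1 - 2%:R^-1 = 2%:R^-1 :> C by field.
Qed.

End OneMember.

Hypothesis d_eps : d%:R * eps <= 1.

(** The first blocks give [P - P'] and [P W_b - P' W'_b] up to [d eta], hence [P D] up to [2 d eta]
    per entry, where [D = W_b - W'_b] and [d_eps] absorbs the factor [W'_b]. Since [P] is close to
    1, [norm1 D] is at most [norm1 (P D)] plus half of itself, which yields the constant [4 d^3]. *)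
Lemma choi_family_separated W P W' P' (eta : C) :
  admissible eps W P -> admissible eps W' P' ->
  (forall r s, `|choi_family W P r s - choi_family W' P' r s| <= eta) ->
  forall b i j, `|W b i j - W' b i j| <= 4%:R * d%:R ^+ 3 * eta.
Proof.
move=> WP WP' hX b i j.
have [W_le P_eq] := WP; have [W_le' _] := WP'.
have d0 : 0 < d%:R :> C by rewrite ltr0n.
have eta0 : 0 <= eta by exact: le_trans (hX (mxtens_index (i, ord0)) (mxtens_index (i, ord0))).
have hb b' k l : `|(P *m blocks W b' - P' *m blocks W' b') k l| <= d%:R * eta.
  have -> : (P *m blocks W b' - P' *m blocks W' b') k l =
    d%:R * (first_block (choi_family W P) b' k l - first_block (choi_family W' P') b' k l).
    rewrite !choi_family_first_block mulrBr.
    have sE (A : 'M[C]_d) : d%:R * (d%:R^-1 *: A) k l = A k l.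
      by rewrite mxE mulrA mulfV ?(gt_eqF d0) // mul1r.
    have subE (A1 A2 : 'M[C]_d) : (A1 - A2) k l = A1 k l - A2 k l by rewrite !mxE.
    by rewrite !sE subE.
  by rewrite normrM (ger0_norm (ltW d0)) (ler_wpM2l (ltW d0)) // ![first_block _ _ _ _]mxE.
have h0 := hb ord0; have {hb} h1 := hb (lift ord0 b).
rewrite /blocks unlift_none !mulmx1 in h0; rewrite /blocks liftK in h1.
set D := W b - W' b.
have PD : norm1 (P *m D) <= d%:R ^+ 2 * (2%:R * d%:R * eta).
  apply: norm1_le => k l.
  have -> : P *m D = (P *m W b - P' *m W' b) - (P - P') *m W' b.
    by rewrite /D mulmxBr mulmxBl opprB addrA subrK.
  have subE (A1 A2 : 'M[C]_d) : (A1 - A2) k l = A1 k l - A2 k l by rewrite !mxE.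
  rewrite subE (le_trans (ler_normB _ _)) //.
  have -> : 2%:R * d%:R * eta = d%:R * eta + 1 * (d%:R * eta) by ring.
  rewrite lerD //; apply: (@le_trans _ _ (d%:R * eps * (d%:R * eta))); last first.
    by rewrite ler_wpM2r // mulr_ge0 // (ltW d0).
  rewrite mxE (le_trans (ler_norm_sum _ _ _)) //.
  rewrite -mulrA mulr_natl -[X in _ *+ X]card_ord -sumr_const ler_sum // => s _.
  by rewrite normrM mulrC ler_pM.
have ED : norm1 ((P - 1%:M) *m D) <= 2%:R^-1 * norm1 D.
  rewrite /norm1 exchange_big [X in _ <= _ * X]exchange_big /= mulr_sumr.
  apply: ler_sum => l _.
  apply: (@le_trans _ _ (\sum_(k < d) \sum_s (2%:R * d%:R)^-1 * `|D s l|)).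
    apply: ler_sum => k _; rewrite mxE (le_trans (ler_norm_sum _ _ _)) //.
    apply: ler_sum => s _; rewrite normrM ler_wpM2r //.
    exact: (normalizer_near1 _ _ eps_ge0 W_le eps_small _ P_eq).
  rewrite sumr_const card_ord -mulr_sumr -[_ *+ d]mulr_natl mulrA invfM mulrCA.
  by rewrite divff ?(gt_eqF d0) // mulr1.
have : norm1 D <= d%:R ^+ 2 * (2%:R * d%:R * eta) + 2%:R^-1 * norm1 D.
  have {1}-> : D = P *m D + - ((P - 1%:M) *m D).
    by rewrite mulmxBl mul1mx opprB addrCA subrr addr0.
  by rewrite (le_trans (norm1D _ _)) // norm1N lerD.
rewrite -lerBlDr => hD.
have -> : W b i j - W' b i j = D i j by rewrite !mxE.
apply: (le_trans (entry_le_norm1 _ _ _)).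
have -> : norm1 D = 2%:R * (norm1 D - 2%:R^-1 * norm1 D) by field.
have -> : 4%:R * d%:R ^+ 3 * eta = 2%:R * (d%:R ^+ 2 * (2%:R * d%:R * eta)) by ring.
by rewrite ler_wpM2l.
Qed.

End ExtremeFamily.

(** * Choi states of isometries: rank and Lipschitz dependence *)

Section ChoiState.
Context {R : realType} {dA dB dC : nat}.
Local Notation C := (R[i]).
Implicit Types V : 'M[C]_(dC * dB, dA).

Lemma choi_stateE V i b j b' :
  choi_state V (mxtens_index (i, b)) (mxtens_index (j, b')) =
  dA%:R^-1 * \sum_c V (mxtens_index (c, b)) i * (V (mxtens_index (c, b')) j)^*.
Proof.
rewrite mxE; congr (_ * _); rewrite summxE (bigD1 i) //= [X in _ + X]big1 ?addr0; last first.
  move=> k ki; rewrite summxE big1 // => l _.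
  by rewrite tensmxE mxE eq_sym (negPf ki) mul0r.
rewrite summxE (bigD1 j) //= [X in _ + X]big1 ?addr0; last first.
  by move=> l lj; rewrite tensmxE mxE [j == l]eq_sym (negPf lj) andbF mul0r.
rewrite tensmxE [delta_mx i j i j]mxE !eqxx mul1r mxE; apply: eq_bigr => c _.
rewrite -(mul_delta_mx (0 : 'I_1)) mulmxA -colE -mulmxA -rowE.
by rewrite mxE big_ord1 !mxE.
Qed.

(** The columns of [G] are the vectorized Kraus operators of the channel, one for each index of the
    traced-out factor. *)
Lemma rank_choi_state V : (\rank (choi_state V) <= dC)%N.
Proof.
pose G : 'M[C]_(dA * dB, dC) :=
  \matrix_(s, c) V (mxtens_index (c, (mxtens_unindex s).2)) (mxtens_unindex s).1.
suff -> : choi_state V = (dA%:R^-1 *: G) *m adjmx G by exact: mulmx_max_rank.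
apply/matrixP => r s; case: (mxtens_indexP r) => i b; case: (mxtens_indexP s) => j b'.
rewrite choi_stateE -scalemxAl !mxE; congr (_ * _); apply: eq_bigr => c _.
by rewrite !mxE !mxtens_indexK.
Qed.

Lemma isometry_entry_le1 V (s : 'I_(dC * dB)) (i : 'I_dA) : Defs.isometry V -> `|V s i| <= 1.
Proof.
move=> isoV; rewrite -(@ler_pXn2r _ 2) ?nnegrE // expr1n.
have := congr1 (fun A : 'M[C]_dA => A i i) isoV; rewrite !mxE eqxx => e.
rewrite -[leRHS]/((true : nat)%:R : C) -e.
rewrite (bigD1 s) //= adjmxE -normCKC lerDl sumr_ge0 // => t _.
by rewrite adjmxE -normCKC exprn_ge0.
Qed.

(** Each of the [dC] summands is a product of two entries of modulus at most 1, so it varies by at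
    most [2 eta]; the prefactor [1 / dA] is at most 1. *)
Lemma choi_state_lipschitz V V' (eta : C) : Defs.isometry V -> Defs.isometry V' ->
  (forall (s : 'I_(dC * dB)) (i : 'I_dA), `|V s i - V' s i| <= eta) ->
  forall r s, `|choi_state V r s - choi_state V' r s| <= dC%:R * (2%:R * eta).
Proof.
move=> isoV isoV' hV r s.
case: (mxtens_indexP r) => i b; case: (mxtens_indexP s) => j b'.
rewrite !choi_stateE -mulrBr -sumrB normrM.
have dA0 : 0 < dA%:R :> C by rewrite ltr0n; case: (dA) i => // -[].
rewrite -[leRHS]mul1r ler_pM //.
  by rewrite ger0_norm ?invr_ge0 ?(ltW dA0) // invf_le1 // ler1n -(ltr0n C).
rewrite (le_trans (ler_norm_sum _ _ _)) // mulr_natl -[X in _ *+ X]card_ord -sumr_const.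
apply: ler_sum => c _; set x := V _ i; set y := V _ j; set x' := V' _ i; set y' := V' _ j.
have -> : x * y^* - x' * y'^* = x * (y - y')^* + (x - x') * y'^*.
  by rewrite rmorphB mulrBr mulrBl addrA subrK.
rewrite (le_trans (ler_normD _ _)) // mulr_natl mulr2n !normrM !norm_conjC.
rewrite lerD //.
  by rewrite -[leRHS]mul1r; apply: ler_pM => //; [exact: isometry_entry_le1 | exact: hV].
by rewrite -[leRHS]mulr1; apply: ler_pM => //; [exact: hV | exact: isometry_entry_le1].
Qed.

End ChoiState.

(** * Smooth functions are Lipschitz on the cube *)

Section Lipschitz.
Context {R : realType} {p : nat}.
Implicit Types (x y z : 'rV[R]_p) (f : 'rV[R]_p -> R).
Local Notation e_ k := (delta_mx 0 k : 'rV[R]_p).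

Lemma param_cube_compact : compact (@param_cube R p).
Proof.
have := @rV_compact R p (fun=> `[0 : R, 2 * pi]%classic) (fun=> @segment_compact R _ _).
congr compact; apply/seteqP; split => x /= hx k; have := hx k; rewrite /= in_itv //.
Qed.

Lemma continuous_bounded_on_cube f :
  (forall x, param_cube x -> {for x, continuous f}) ->
  exists2 M : R, 0 <= M & forall x, param_cube x -> `|f x| <= M.
Proof.
move=> cf.
have /compact_bounded [M [Mr hM]] : compact (f @` @param_cube R p)%classic.
  apply: continuous_compact param_cube_compact.
  by apply: continuous_in_subspaceT => x /set_mem; exact: cf.
exists (`|M| + 1) => [|x hx]; first by rewrite addr_ge0.
apply: (hM (`|M| + 1)); last by exists x.
by rewrite ltr_pwDr // ler_norm.
Qed.

(** Turns a partial derivative into a one-variable one, for the mean value theorem on segments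
    parallel to an axis. *)
Lemma derive_along f z k s :
  derivable f (z + s *: e_ k) (e_ k) ->
  is_derive s 1 (fun t : R => f (z + t *: e_ k)) ('D_(e_ k) f (z + s *: e_ k)).
Proof.
have E : (fun h : R => h^-1 *: (((fun t => f (z + t *: e_ k)) \o shift s) (h *: 1) -
                        f (z + s *: e_ k)))
       = (fun h : R => h^-1 *: ((f \o shift (z + s *: e_ k)) (h *: e_ k) -
                        f (z + s *: e_ k))).
  apply/funext => h /=; congr (_ *: (f _ - _)).
  have -> : h *: (1 : R) = h by exact: mulr1.
  by rewrite scalerDl addrCA.
by move=> df; apply: DeriveDef; [rewrite /derivable E | rewrite /derive E].
Qed.

Lemma coordinate_lipschitz f k (M : R) z a b :
  (forall x, param_cube x -> derivable f x (e_ k)) ->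
  (forall x, param_cube x -> `|'D_(e_ k) f x| <= M) ->
  a <= b -> param_cube (z + a *: e_ k) -> param_cube (z + b *: e_ k) ->
  `|f (z + b *: e_ k) - f (z + a *: e_ k)| <= M * (b - a).
Proof.
move=> df Mf ab ha hb.
have hs s : s \in `[a, b] -> param_cube (z + s *: e_ k).
  rewrite in_itv /= => /andP[as_ sb] j; have := ha j; have := hb j; rewrite !mxE.
  case: (j == k) => /=; rewrite ?mulr0 ?mulr1 //; first by move=> /andP[? ?] /andP[? ?]; lra.
have [||c hc ->] := @MVT_segment R (fun t => f (z + t *: e_ k))
  (fun t => 'D_(e_ k) f (z + t *: e_ k)) a b ab.
- by move=> s sab; apply/derive_along/df/hs; apply: subset_itv_oo_cc.
- apply: derivable_within_continuous => s sab.
  by have [] := derive_along f z k s (df _ (hs _ sab)).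
by rewrite normrM [X in _ * X]ger0_norm ?subr_ge0 // ler_wpM2r ?subr_ge0 // Mf //; exact: hs.
Qed.

(** Pass from [y] to [x] one coordinate at a time. The intermediate points [z j] stay in the cube
    because it is a product, and each partial derivative is bounded there by compactness. *)
Lemma smooth_lipschitz (U : set 'rV[R]_p) f : smooth_on U f ->
  (forall x, param_cube x -> U x) ->
  exists2 L : R, 0 <= L & forall (eta : R) x y, param_cube x -> param_cube y ->
    (forall k, `|x 0 k - y 0 k| <= eta) -> `|f x - f y| <= L * eta.
Proof.
move=> sf sU.
have df k x : param_cube x -> derivable f x (e_ k).
  by move=> /sU hx; have [_] := sf [::] x hx.
have /choice[M hM] : forall k, exists M : R, 0 <= M /\
    forall x, param_cube x -> `|'D_(e_ k) f x| <= M.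
  move=> k; have [|M M0 hM] := @continuous_bounded_on_cube (partialD k f).
    by move=> x /sU hx; have [+ _] := sf [:: k] x hx.
  by exists M.
exists (\sum_k M k) => [|eta x y hx hy xy]; first by rewrite sumr_ge0 // => k _; case: (hM k).
pose z j : 'rV[R]_p := \row_k (if (k < j)%N then x 0 k else y 0 k).
have hz j : param_cube (z j) by move=> k; rewrite mxE; case: ifP.
have -> : x = z p by apply/rowP => k; rewrite mxE ltn_ord.
have -> : y = z 0%N by apply/rowP => k; rewrite mxE.
rewrite -(telescope_sumr (fun j => f (z j)) (leq0n p)) big_mkord mulr_suml.
rewrite (le_trans (ler_norm_sum _ _ _)) // ler_sum // => k _.
have zE : z k.+1 = z k + (x 0 k - y 0 k) *: e_ k.
  apply/rowP => j; rewrite !mxE eqxx /= ltnS leq_eqVlt; case: (eqVneq j k) => [->|jk].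
    by rewrite eqxx ltnn /= mulr1 addrC subrK.
  by rewrite (inj_eq val_inj) (negPf jk) /= mulr0 addr0.
have [M0 Mk] := hM k.
apply: (@le_trans _ _ (M k * `|x 0 k - y 0 k|)); last by rewrite ler_wpM2l.
have z0 : z k = z k + 0 *: e_ k by rewrite scale0r addr0.
case: (lerP 0 (x 0 k - y 0 k)) => [h|/ltW h].
  rewrite {1}z0 zE (ger0_norm h) -[X in M k * X]subr0.
  by apply: (coordinate_lipschitz f k (M k) (z k) 0 (x 0 k - y 0 k)) => //;
    [exact: df | rewrite -z0 | rewrite -zE].
rewrite distrC {1}z0 zE (ler0_norm h) -[X in M k * X]sub0r.
by apply: coordinate_lipschitz => //; [exact: df | rewrite -zE | rewrite -z0].
Qed.

End Lipschitz.

(** * Complex modulus versus real and imaginary parts *)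

Section ComplexNorm.
Context {R : realType}.
Local Notation C := (R[i]).

Lemma normc_real (r : R) : `|(r%:C)%C : C| = (`|r|%:C)%C.
Proof. by rewrite normc_def /= expr0n addr0 sqrtr_sqr. Qed.

Lemma normc_ge_Im (z : C) : (`|complex.Im z|%:C)%C <= `|z|.
Proof. by rewrite normc_def lecR -sqrtr_sqr ler_wsqrtr // lerDr sqr_ge0. Qed.

Lemma normc_le_ReIm (z : C) :
  `|z| <= ((`|complex.Re z| + `|complex.Im z|)%:C)%C.
Proof.
rewrite {1}[z]complexE (le_trans (ler_normD _ _)) // normrM !normc_real rmorphD /=.
by rewrite lerD // normc_def /= expr0n expr1n add0r sqrtr1 mul1r.
Qed.

End ComplexNorm.

(** * Covering the image of a circuit by small balls *)

Section Covering.
Context {R : realType} {dA dB dC p : nat}.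
Local Notation C := (R[i]).

Lemma round_down (N : nat) (t : R) : 0 <= t <= N.+1%:R ->
  exists k : 'I_N.+1, `|t - k%:R| <= 1.
Proof.
move=> /andP[t0 tN]; have [tlt|tge] := ltP t N.+1%:R.
  have /andP[h1 h2] := truncn_itv t0.
  have kN : (Num.truncn t < N.+1)%N by rewrite -(ltr_nat R) (le_lt_trans h1).
  exists (Ordinal kN); rewrite ger0_norm /= ?subr_ge0 // lerBlDl ltW //.
  by rewrite -natr1 addrC in h2; rewrite addrC.
(* The right endpoint has no index of its own; the last index [N] is at distance exactly 1. *)
exists ord_max; have -> : t = N.+1%:R by apply/le_anti/andP.
by rewrite -natr1 addrAC subrr add0r normr1.
Qed.

(** The centers are the images of a regular grid of the cube. [L] is fixed before [N], so the mesh
    can be refined at will. *)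
Lemma circuit_covering (h : 'rV[R]_p -> 'M[C]_(dC * dB, dA)) :
  circuit_topology h ->
  exists L : R, 0 <= L /\ forall N : nat, exists2 s : seq 'M[C]_(dA * dB),
    size s = (N.+1 ^ p)%N &
    forall X, generated_set h X -> exists2 Y, Y \in s &
      forall r t, `|X r t - Y r t| <= ((L / N.+1%:R)%:C)%C.
Proof.
move=> [_ [_ [iso_h [U [g [_ [cU [gh sg]]]]]]]].
have /choice[La hLa] : forall ab : 'I_(dC * dB) * 'I_dA, exists L : R, 0 <= L /\
    forall (eta : R) x y, param_cube x -> param_cube y ->
    (forall k, `|x 0 k - y 0 k| <= eta) ->
    `|h x ab.1 ab.2 - h y ab.1 ab.2| <= ((L * eta)%:C)%C.
  move=> [a b] /=; have [sR sI] := sg a b.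
  have [L1 L10 h1] := smooth_lipschitz _ _ sR cU.
  have [L2 L20 h2] := smooth_lipschitz _ _ sI cU.
  exists (L1 + L2); split=> [|eta x y hx hy xy]; first exact: addr_ge0.
  rewrite -!gh //; apply: (le_trans (normc_le_ReIm _)).
  by rewrite lecR mulrDl lerD // raddfB /=; [exact: h1 | exact: h2].
pose L := \sum_ab La ab.
have L0 : 0 <= L by apply: sumr_ge0 => ab _; case: (hLa ab).
have pi0 : 0 < 2 * pi :> R by rewrite mulr_gt0 // pi_gt0.
(* [dC * 2] comes from [choi_state_lipschitz], [L] bounds the entries of [h], and [2 * pi / N.+1] is
   the mesh. *)
exists (dC%:R * (2 * (L * (2 * pi)))); split.
  by rewrite !mulr_ge0 // ?pi_ge0.
move=> N.
pose pt (k : {ffun 'I_p -> 'I_N.+1}) : 'rV[R]_p := \row_j ((2 * pi) * ((k j)%:R / N.+1%:R)).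
have N0 : 0 < N.+1%:R :> R by rewrite ltr0n.
have pt_cube k : param_cube (pt k).
  move=> j; rewrite mxE mulr_ge0 ?divr_ge0 ?(ltW pi0) //=.
  by rewrite ler_piMr ?(ltW pi0) // ler_pdivrMr // mul1r ler_nat ltnW // ltnS.
exists [seq choi_state (h (pt k)) | k : {ffun 'I_p -> 'I_N.+1}].
  by rewrite size_image card_ffun !card_ord.
move=> X [x [hx <-]].
have /fin_all_exists[k hk] : forall j, exists k : 'I_N.+1,
    `|x 0 j / (2 * pi) * N.+1%:R - k%:R| <= 1.
  move=> j; apply: round_down; have /andP[x0 x1] := hx j.
  rewrite mulr_ge0 ?divr_ge0 ?(ltW pi0) //=.
  by rewrite ler_piMl // ler_pdivrMr // mul1r.
exists (choi_state (h (pt (finfun k)))); first by apply/mapP; exists (finfun k); rewrite ?mem_enum.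
have xk j : `|x 0 j - pt (finfun k) 0 j| <= 2 * pi / N.+1%:R.
  rewrite mxE ffunE.
  have -> : x 0 j - 2 * pi * ((k j)%:R / N.+1%:R) =
    (x 0 j / (2 * pi) * N.+1%:R - (k j)%:R) * (2 * pi / N.+1%:R).
    move: (2 * pi) N.+1%:R pi0 N0 => a n1 a0 n10.
    by field; rewrite !gt_eqF.
  have q0 : 0 <= 2 * pi / N.+1%:R :> R by rewrite divr_ge0 // ltW.
  by rewrite normrM [X in _ * X]ger0_norm // ler_piMl.
move=> r t.
have hL a b : `|h x a b - h (pt (finfun k)) a b| <= ((L * (2 * pi / N.+1%:R))%:C)%C.
  have [La0 hab] := hLa (a, b).
  apply: (le_trans (hab _ _ _ hx (pt_cube _) xk)).
  rewrite lecR ler_wpM2r //; first by rewrite divr_ge0 // ltW.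
  rewrite /L (bigD1 (a, b)) //= lerDl sumr_ge0 // => ab _; by case: (hLa ab).
have := choi_state_lipschitz _ _ _ (iso_h _ hx) (iso_h _ (pt_cube _)) hL r t.
congr (_ <= _).
have cN (n : nat) : n%:R = ((n%:R : R)%:C)%C :> C by rewrite rmorph_nat.
rewrite !cN -!rmorphM /=; congr (_ %:C)%C.
by rewrite !mulrA.
Qed.

End Covering.

(** Pigeonhole: if every [g] were near some point of [s], choosing such points would inject [G] into
    [s]. *)
Lemma exists_unmatched (G : finType) (T : eqType) (s : seq T) (near : G -> T -> Prop) :
  (size s < #|G|)%N -> (forall g g' y, near g y -> near g' y -> g = g') ->
  exists g, forall y, y \in s -> ~ near g y.
Proof.
move=> sG inj; apply: contrapT => /forallNP all_near.
have /choice[f hf] : forall g, exists y, y \in s /\ near g y.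
  move=> g; apply: contrapT => /forallNP no; apply: (all_near g) => y ys gy.
  exact: (no y).
have f_inj : injective f.
  by move=> g g' e; apply: (inj g g' (f g)); [case: (hf g) | rewrite e; case: (hf g')].
move: sG; rewrite ltnNge cardE -(size_map f) uniq_leq_size //.
  by rewrite map_inj_uniq ?enum_uniq.
by move=> _ /mapP[g _ ->]; case: (hf g).
Qed.

(** * A separated grid of prescribed blocks *)

Section Grid.
Context {R : realType} {d m M : nat}.
Local Notation C := (R[i]).

(** One coordinate for each block, row and column, the boolean telling real from imaginary part:
    [2 d^2 m] coordinates in all. *)
Definition grid := {ffun 'I_m * 'I_d * 'I_d * bool -> 'I_M}.

Lemma card_grid : #|grid| = (M ^ (2 * d ^ 2 * m))%N.
Proof.
rewrite card_ffun !card_prod !card_ord card_bool; congr (_ ^ _)%N.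
by rewrite -mulnn [RHS]mulnAC mulnC -(mulnA m) mulnA.
Qed.

Definition grid_blocks (delta : R) (g : grid) (b : 'I_m) : 'M[C]_d :=
  \matrix_(i, j) Complex (delta * (g (b, i, j, true))%:R) (delta * (g (b, i, j, false))%:R).

Lemma grid_blocks_le delta g b i j : 0 <= delta ->
  `|grid_blocks delta g b i j| <= ((delta * (2 * M%:R))%:C)%C.
Proof.
move=> d0; rewrite mxE (le_trans (normc_le_ReIm _)) //= lecR.
rewrite !ger0_norm ?mulr_ge0 // -mulrDr ler_wpM2l // mulr_natl mulr2n.
by rewrite lerD // ler_nat ltnW.
Qed.

Lemma grid_blocks_separated delta (g g' : grid) : 0 <= delta -> g != g' ->
  exists b i j, (delta%:C)%C <= `|grid_blocks delta g b i j - grid_blocks delta g' b i j|.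
Proof.
move=> d0 gg'; have [[[[b i] j] t] gt] : exists u, g u != g' u.
  apply: contrapT => /forallNP no; move/eqP: gg'; apply; apply/ffunP => u.
  by apply/eqP/negPn/negP/no.
have sep (k l : 'I_M) : k != l -> delta <= `|delta * k%:R - delta * l%:R|.
  move=> kl; rewrite -mulrBr normrM ger0_norm // ler_peMr //.
  have ltS (a c : 'I_M) : (a < c)%N -> 1 <= `|(a%:R : R) - c%:R|.
    move=> ac; rewrite distrC ger0_norm ?subr_ge0 ?ler_nat 1?ltnW //.
    by rewrite lerBrDr addrC natr1 ler_nat.
  have : (k : nat) != l by [].
  by rewrite neq_ltn => /orP[/ltS//|/ltS]; rewrite distrC.
exists b, i, j; rewrite !mxE; case: t gt => gt.
  by apply: le_trans (normc_ge_Re _); rewrite lecR /=; exact: sep.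
by apply: le_trans (normc_ge_Im _); rewrite lecR /=; exact: sep.
Qed.

End Grid.

(** * Choice of constants and the counting argument *)

Theorem theorem6 (R : realType) (dA dB q : nat)
  (dC : 'I_q -> nat) (p : 'I_q -> nat)
  (h : forall i : 'I_q, 'rV[R]_(p i) -> 'M[R[i]]_(dC i * dB, dA)) :
  (0 < dA)%N -> (0 < dB)%N ->
  (forall i, circuit_topology (h i)) ->
  (forall i, (p i < 2 * dA ^ 2 * (dB - 1))%N \/ (dC i < dA)%N) ->
  exists E0 : 'M[R[i]]_(dA * dB),
    choi_extreme_rank dA E0 /\
    exists e : R, 0 < e /\
      forall E : 'M[R[i]]_(dA * dB), choi_set E ->
        (forall r s, `|E r s - E0 r s| < (e%:C)%C) ->
        forall i : 'I_q, ~ generated_set (h i) E.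
Proof.
case: dB h => [//|m] h dA0 _ hZ; rewrite subn1 /= => hp.
set D := (2 * dA ^ 2 * m)%N in hp *.
pose d : R := dA%:R; have d0 : 0 < d by rewrite ltr0n.
pose n : R := m.+1%:R; have n0 : 0 < n by rewrite ltr0n.
(* Then [n (d eps) = 1/2], which gives both [d eps <= 1] and [m eps^2 d^2 <= 1/4]. *)
pose eps : R := (2 * n * d)^-1.
have eps0 : 0 < eps by rewrite invr_gt0 !mulr_gt0.
have epsd : eps * (2 * n * d) = 1 by rewrite mulVf // gt_eqF // !mulr_gt0.
have n1 : 1 <= n by rewrite ler1n.
have epsd_le : d * eps <= 1.
  have : 0 <= d * eps by rewrite mulr_ge0 ?ltW.
  by nra.
have /choice[L hL] := fun i => circuit_covering (h i) (hZ i).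
pose Lm := \sum_i L i + 1.
have Lsum0 : 0 <= \sum_i L i by apply: sumr_ge0 => i _; case: (hL i).
have Lm0 : 0 < Lm by rewrite ltr_wpDl.
have L_le i : L i <= Lm.
  rewrite /Lm (bigD1 i) //= -addrA lerDl addr_ge0 // sumr_ge0 // => j _; by case: (hL j).
(* [K] makes [4 d^3 * (2 rho) = 16 d^3 Lm / (K M)] smaller than [delta = eps / (2 M)], whatever [M]
   is. *)
pose K := (Num.truncn (32 * d ^+ 3 * Lm / eps)).+1.
have K_gt : 32 * d ^+ 3 * Lm / eps < K%:R by exact: truncnS_gt.
(* With [M] above this sum, the number of centers is at most
   [(\sum_i K ^ p i) * M ^ (D - 1) < M ^ D] when [D > 0]. *)
pose M := (\sum_i K ^ p i).+1.
have KM0 : (0 < K * M)%N by [].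
pose N := (K * M)%N.-1.
have NE : N.+1 = (K * M)%N by rewrite /N prednK.
have /choice[s hs] : forall i, exists s : seq 'M[R[i]]_(dA * m.+1),
    size s = ((K * M) ^ p i)%N /\
    forall X, generated_set (h i) X -> exists2 Y, Y \in s &
      forall r t, `|X r t - Y r t| <= ((Lm / (K * M)%:R)%:C)%C.
  move=> i; have [_ /(_ N)[s]] := hL i; rewrite NE => ss hs; exists s; split=> // X gX.
  have [Y Ys XY] := hs X gX; exists Y => // r t; apply: (le_trans (XY r t)).
  by rewrite lecR ler_wpM2r ?invr_ge0.
pose centers := flatten [seq s i | i <- enum 'I_q & (p i < D)%N].
(* Twice the covering radius: one half is spent on the covering, the other on the neighborhood of
   the chosen state. *)
pose rho : R := 2 * (Lm / (K * M)%:R).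
pose delta : R := eps / (2 * M%:R).
have M0 : 0 < M%:R :> R by rewrite ltr0n.
have K0 : 0 < K%:R :> R by rewrite ltr0n.
have delta0 : 0 < delta by rewrite divr_gt0 // mulr_gt0.
pose epsC : R[i] := (eps%:C)%C.
have natC (k : nat) : k%:R = ((k%:R : R)%:C)%C :> R[i] by rewrite rmorph_nat.
have epsC0 : 0 <= epsC by rewrite ler0c ltW.
have epsC_small : m%:R * epsC ^+ 2 * dA%:R ^+ 2 <= 4%:R^-1.
  have -> : m%:R * epsC ^+ 2 * dA%:R ^+ 2 = ((m%:R * eps ^+ 2 * d ^+ 2)%:C)%C.
    by rewrite rmorphM /= [X in _ = X * _]rmorphM /= !rmorphXn /= !rmorph_nat.
  rewrite natC -fmorphV lecR.
  have mn : m%:R <= n :> R by rewrite ler_nat.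
  have -> : m%:R * eps ^+ 2 * d ^+ 2 = m%:R * (d * eps) ^+ 2 by ring.
  have m0 : 0 <= m%:R :> R by [].
  have e1 : 2 * n * (d * eps) = 1 by rewrite -[RHS]epsd; ring.
  have x0 : 0 <= d * eps by rewrite mulr_ge0 ?ltW.
  move: (d * eps) e1 x0 => x e1 x0.
  apply: (@le_trans _ _ (n * x * (n * x))).
    rewrite expr2; nra.
  have -> : n * x = 2^-1 by lra.
  lra.
have d_epsC : dA%:R * epsC <= 1 by rewrite natC -rmorphM lecR.
pose W (g : @grid dA m M) := grid_blocks delta g.
have W_le g b i j : `|W g b i j| <= epsC.
  have -> : epsC = ((delta * (2 * M%:R))%:C)%C.
    by rewrite /delta divfK // mulf_neq0 ?gt_eqF.
  exact/grid_blocks_le/ltW.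
have /choice[P hP] : forall g, exists P, admissible epsC (W g) P.
  move=> g; have [P hP] := exists_normalizer _ _ (W_le g) epsC_small.
  by exists P; split.
pose X g := choi_family (W g) (P g).
pose near (g : @grid dA m M) (Y : 'M[R[i]]_(dA * m.+1)) :=
  forall r t, `|X g r t - Y r t| <= (rho%:C)%C.
have rho0 : 0 < rho by rewrite mulr_gt0 // divr_gt0 // natrM mulr_gt0.
have [g hg] : exists g, forall Y, Y \in centers -> ~ near g Y.
  apply: exists_unmatched => [|g g' Y gY g'Y].
    rewrite card_grid -/D size_flatten /shape -map_comp sumnE big_map big_filter big_enum_cond /=.
    under eq_bigr do rewrite (hs _).1.
    (* If [D = 0], no circuit has fewer than [D] parameters, so there are no centers, while the grid
       has one point. *)
    have [D0|D0] := posnP D.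
      by rewrite big1 ?D0 // => i; rewrite D0.
    apply: (@leq_ltn_trans (\sum_i K ^ p i * M ^ D.-1)); last first.
      by rewrite -big_distrl /= -[in leqRHS](prednK D0) expnS ltn_mul2r expn_gt0 ltnS leqnn.
    rewrite [leqRHS](bigID (fun i => p i < D)%N) /= -[leqLHS]addn0 leq_add //.
    apply: leq_sum => i pD; rewrite expnMn leq_mul2l leq_pexp2l ?orbT //.
    by rewrite -ltnS prednK.
  (* Two members near one center are within [2 * rho] of each other, so by separation their blocks
     are closer than the mesh [delta]. *)
  apply: contrapT => /eqP/(grid_blocks_separated _ _ _ (ltW delta0))[b [i [j hd]]].
  have XX r t : `|choi_family (W g) (P g) r t - choi_family (W g') (P g') r t|
      <= ((2 * rho)%:C)%C.
    have -> : choi_family (W g) (P g) r t - choi_family (W g') (P g') r t =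
      (X g r t - Y r t) - (X g' r t - Y r t) by rewrite opprB addrA subrK.
    by rewrite (le_trans (ler_normB _ _)) // mulr_natl mulr2n rmorphD lerD.
  have := le_trans hd (choi_family_separated _ dA0 epsC0 epsC_small d_epsC _ _ _ _ _
    (hP g) (hP g') XX b i j).
  have -> : 4%:R * dA%:R ^+ 3 * ((2 * rho)%:C)%C = ((4 * d ^+ 3 * (2 * rho))%:C)%C :> R[i].
    by rewrite [RHS]rmorphM; congr (_ * _); rewrite rmorphM /= rmorphXn !rmorph_nat.
  rewrite lecR leNgt => /negP; apply.
  rewrite /rho /delta natrM.
  have -> : 4%:R * d ^+ 3 * (2 * (2 * (Lm / (K%:R * M%:R)))) =
     (32 * d ^+ 3 * Lm / eps) * (eps / (2 * M%:R) / K%:R).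
    by move: (gt_eqF K0) (gt_eqF M0) (gt_eqF eps0) => ? ? ?; field; apply/and3P; split; apply/negbT.
  by rewrite mulrCA gtr_pMr // ltr_pdivrMr // mul1r.
have dC0 : 0 < (4 * d ^+ 2)^-1 by rewrite invr_gt0 mulr_gt0 // exprn_gt0.
exists (X g); split.
  exact: (choi_family_extreme _ dA0 epsC0 epsC_small _ _ (hP g)).
(* The first bound keeps [E] off the covering balls; the second keeps its rank at least [dA], as
   [d^2 / (4 d^2) < 1/2]. *)
exists (Num.min (rho / 2) (4 * d ^+ 2)^-1); split.
  by rewrite lt_min dC0 divr_gt0.
move=> E hE EX i gE.
have [|dCi] := hp i => [p_lt|].
  have [Y Ys EY] := (hs i).2 _ gE.
  apply: (hg Y).
    by apply/flatten_mapP; exists i => //; rewrite mem_filter p_lt mem_enum.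
  move=> r t.
  have -> : X g r t - Y r t = (E r t - Y r t) - (E r t - X g r t).
    by rewrite opprB [RHS]addrC addrA subrK.
  have -> : rho = Lm / (K * M)%:R + rho / 2 by rewrite /rho; move: (Lm / _) => a; field.
  rewrite rmorphD (le_trans (ler_normB _ _)) // lerD //.
  by rewrite (le_trans (ltW (EX r t))) // lecR ge_min lexx.
have : (dA <= \rank E)%N.
  apply: (rank_near_choi_family _ dA0 epsC0 epsC_small _ _ (hP g) _ (((4 * d ^+ 2)^-1)%:C)%C).
    have -> : dA%:R ^+ 2 * (((4 * d ^+ 2)^-1)%:C)%C = ((d ^+ 2 * (4 * d ^+ 2)^-1)%:C)%C :> R[i].
      by rewrite rmorphM rmorphXn rmorph_nat.
    rewrite natC -fmorphV ltcR.
    have -> : d ^+ 2 * (4 * d ^+ 2)^-1 = 4^-1 by field; rewrite gt_eqF.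
    by lra.
  by move=> r t; rewrite (le_trans (ltW (EX r t))) // lecR ge_min lexx orbT.
case: gE => x [_ <-]; rewrite leqNgt => /negP; apply.
exact: leq_ltn_trans (rank_choi_state _) dCi.
Qed.
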